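(* Let $k,m,n\in\mathbb N$ with $m\leq n$. Let $M$ be a $k\times m$ matrix with rational entries which is image partition regular over $\mathbb N$. Let $F$ be a finite nonempty set of $S_0$-preserving homomorphisms from $S_n$ to $S_0$ and let $\sigma$ be an injection from $\{1,\dots,m\}$ to $\{1,\dots,n\}$. Then $P_{M,F,\sigma}$ is a compact subsemigroup of $(\beta\mathbb N)^k$ containing $\{(p,p,\ldots,p)\in(\beta\mathbb N)^k: p \text{ is a minimal idempotent of } \beta\mathbb N\}$.
   Context: $\mathbb A$ is a fixed nonempty finite alphabet, $S_0=\mathbb A^+$ the free semigroup of nonempty words over $\mathbb A$, and $S_n$ the set of nonempty words over $\mathbb A\cup\{v_1,\dots,v_n\}$ (distinct variables not in $\mathbb A$) in which each $v_i$ occurs. A homomorphism $\nu:S_n\to S_0$ is $S_0$-preserving if $\nu(uw)=u\nu(w)$ and $\nu(wu)=\nu(w)u$ for all $u\in S_0,w\in S_n$. $\mu_j(w)=|w|_{v_j}$. $P_{M,F,\sigma}$ is the set of $\vec p=(p_1,\dots,p_k)\in(\beta\mathbb N)^k$ such that whenever $D$ is a piecewise syndetic subset of $S_0$ and $B_i\in p_i$ for all $i\le k$, there exists $w\in S_n$ with $\nu(w)\in D$ for all $\nu\in F$ and $M(\mu_{\sigma(1)}(w),\dots,\mu_{\sigma(m)}(w))^{T}\in\prod_{i=1}^kB_i$. A matrix $M$ is image partition regular over $\mathbb N$ if whenever $\mathbb N$ is finitely colored there is $\vec z\in\mathbb N^m$ with the entries of $M\vec z$ in $\mathbb N$ and monochromatic.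 $\beta\mathbb N$ is the Stone–Čech compactification of $(\mathbb N,+)$ with extended operation; $(\beta\mathbb N)^k$ has product topology and coordinatewise operation. For a discrete semigroup $X$, $K(\beta X)$ is the smallest ideal of $\beta X$; a minimal idempotent is an idempotent in $K(\beta X)$; $D$ is piecewise syndetic if $D\in p$ for some $p\in K(\beta X)$. *)

(* Defs.v *)
From HB Require Import structures.
From mathcomp Require Import all_boot all_order all_algebra.
From mathcomp Require Import all_classical topology.

Set Implicit Arguments.
Unset Strict Implicit.
Unset Printing Implicit Defensive.

Import GRing.Theory Num.Theory.

Local Open Scope classical_set_scope.
Local Open Scope group_scope.

(* beta X, for X discrete: the ultrafilters on X, with the sets
   [set p | ultra p A], A : set X, as a basis of open sets. *)
Record beta (X : Type) := Beta {
  ultra : set_system X;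
  ultraP : UltraFilter ultra
}.
#[global] Existing Instance ultraP.

Lemma beta_inj X (p q : beta X) : ultra p = ultra q -> p = q.
Proof.
case: p q => [p pP] [q qP] /= e; subst q; congr Beta; exact: Prop_irrelevance.
Qed.

HB.instance Definition _ X := gen_eqMixin (beta X).
HB.instance Definition _ X := gen_choiceMixin (beta X).

Section BetaTopology.
Variable X : Type.

Definition beta_base (A : set X) : set (beta X) := [set p | ultra p A].

Let beta_base_cover : \bigcup_(A in setT) beta_base A = setT.
Proof.
rewrite predeqE => p; split=> // _; exists setT => //.
exact: (@filterT _ (ultra p)).
Qed.

Let beta_base_join (A B : set X) (p : beta X) : setT A -> setT B ->
  beta_base A p -> beta_base B p ->
  exists C, [/\ setT C, beta_base C p & beta_base C `<=` beta_base A `&` beta_base B].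
Proof.
move=> _ _ pA pB; exists (A `&` B); split=> //; first exact: filterI.
by move=> q qAB; split; apply: filterS qAB => x [].
Qed.

HB.instance Definition _ :=
  isBaseTopological.Build (beta X) beta_base_cover beta_base_join.

End BetaTopology.

Lemma ultrafilter_setVsetC T (F : set_system T) :
  ProperFilter F -> (forall A, F A \/ F (~` A)) -> UltraFilter F.
Proof.
move=> FP FAC; split=> // G GP FG; rewrite eqEsubset; split=> // A GA.
have [//|/FG GnA] := FAC A.
by have /filter_ex [x []] : G (A `&` ~` A) by exact: filterI.
Qed.

Section BetaSemigroup.
Variable X : semigroupType.
Implicit Types p q r : beta X.

(* A \in p * q iff {x | x^-1 A \in q} \in p, where x^-1 A = {y | x y \in A}:
   the extension making beta X right topological (p |-> p * q is continuous)
   with X contained in the topological center. *)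
Definition beta_mul_val p q : set_system X :=
  [set A | \forall x \near ultra p,
           \forall y \near ultra q, A (x * y)].

Lemma beta_mul_ultra p q : UltraFilter (beta_mul_val p q).
Proof.
apply: ultrafilter_setVsetC; last first.
  move=> A; have [pA|pA] := in_ultra_setVsetC
    [set x | \forall y \near ultra q, A (x * y)] (ultraP p).
    by left.
  right; apply: filterS pA => x /= xA.
  by have [|] := in_ultra_setVsetC [set y | A (x * y)] (ultraP q).
split; first by move=> /(@filter_ex _ (ultra p)) [x /(@filter_ex _ (ultra q)) []].
constructor.
- by apply: (@filterE _ (ultra p)) => x; exact: (@filterE _ (ultra q)).
- move=> A B; apply: (@filterS2 _ (ultra p)) => x.
  exact: (@filterS2 _ (ultra q)).
- move=> A B AB; apply: (@filterS _ (ultra p)) => x.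
  by apply: (@filterS _ (ultra q)) => y; exact: AB.
Qed.

Definition beta_mul p q : beta X := Beta (beta_mul_ultra p q).

Lemma beta_mulA : associative beta_mul.
Proof.
move=> p q r; apply: beta_inj; apply/funext => A.
congr (ultra p _); apply/funext => x; congr (ultra q _); apply/funext => y.
by congr (ultra r _); apply/funext => z; rewrite mulgA.
Qed.

HB.instance Definition _ := isSemigroup.Build (beta X) beta_mulA.

End BetaSemigroup.

Section BetaPower.
Variables (X : semigroupType) (k : nat).

Definition beta_pow : Type := prod_topology (fun _ : 'I_k => beta X).

HB.instance Definition _ := Topological.on beta_pow.

Definition beta_pow_mul (p q : beta_pow) : beta_pow := fun i => p i * q i.

Lemma beta_pow_mulA : associative beta_pow_mul.
Proof. by move=> p q r; apply/funext => i; exact: mulgA. Qed.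

HB.instance Definition _ := isSemigroup.Build beta_pow beta_pow_mulA.

End BetaPower.

Definition subsemigroup (T : semigroupType) (A : set T) :=
  A !=set0 /\ forall x y, A x -> A y -> A (x * y).

Definition ideal (T : semigroupType) (I : set T) :=
  I !=set0 /\ forall x y, I x -> I (x * y) /\ I (y * x).

Definition smallest_ideal (T : semigroupType) : set T :=
  \bigcap_(I in @ideal T) I.

Definition minimal_idempotent (T : semigroupType) : set T :=
  [set e | smallest_ideal e /\ e * e = e].

Definition piecewise_syndetic (X : semigroupType) (D : set X) :=
  exists2 p : beta X, smallest_ideal p & ultra p D.

Definition posnat : Type := {n : nat | (0 < n)%N}.

HB.instance Definition _ := SubCountable.on posnat.

Definition posnat_add (x y : posnat) : posnat :=
  exist _ (val x + val y)%N (ltn_addr (val y) (valP x)).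

Lemma posnat_addC : commutative posnat_add.
Proof. by move=> x y; apply: val_inj; exact: addnC. Qed.

Lemma posnat_addA : associative posnat_add.
Proof. by move=> x y z; apply: val_inj; exact: addnA. Qed.

HB.instance Definition _ :=
  Algebra.isAddSemigroup.Build posnat posnat_addC posnat_addA.

(* The semigroup (N, +), its law being written multiplicatively. *)
Notation posnat_semigroup := (Algebra.to_multiplicative posnat).

Definition posnat_rat (x : posnat) : rat := (val x)%:R%R.

Definition image_partition_regular (k m : nat) (M : 'M[rat]_(k, m)) :=
  forall (C : finType) (c : posnat -> C),
  exists (z : 'cV[posnat]_m) (x : 'cV[posnat]_k),
    (M *m map_mx posnat_rat z)%R = map_mx posnat_rat x /\
    exists a : C, forall i, c (x i ord0) = a.

Section Words.
Variable A : finType.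

Definition word : Type := {u : seq A | u != [::]}.

HB.instance Definition _ := SubCountable.on word.

Lemma word_mul_proof (u v : word) : val u ++ val v != [::].
Proof. by case: u => -[]. Qed.

Definition word_mul (u v : word) : word := exist _ (val u ++ val v) (word_mul_proof u v).

Lemma word_mulA : associative word_mul.
Proof. by move=> u v w; apply: val_inj; exact: catA. Qed.

HB.instance Definition _ := isSemigroup.Build word word_mulA.

Variable n : nat.

(* inl a is the letter a; inr i is the variable v_(i+1). *)
Definition is_varword (w : seq (A + 'I_n)) :=
  (w != [::]) && [forall i, inr i \in w].

Definition varword : Type := {w : seq (A + 'I_n) | is_varword w}.

HB.instance Definition _ := SubCountable.on varword.

Lemma is_varword_catl s w : is_varword w -> is_varword (s ++ w).
Proof.
case/andP=> w0 /forallP wi; apply/andP; split; first by case: s.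
by apply/forallP => i; rewrite mem_cat wi orbT.
Qed.

Lemma is_varword_catr s w : is_varword w -> is_varword (w ++ s).
Proof.
case/andP=> w0 /forallP wi; apply/andP; split; first by case: w w0 wi.
by apply/forallP => i; rewrite mem_cat wi.
Qed.

Definition varword_mul (v w : varword) : varword :=
  exist _ (val v ++ val w) (is_varword_catl (val v) (valP w)).

Lemma varword_mulA : associative varword_mul.
Proof. by move=> u v w; apply: val_inj; exact: catA. Qed.

HB.instance Definition _ := isSemigroup.Build varword varword_mulA.

Definition embed_word (u : word) : seq (A + 'I_n) := map inl (val u).

Definition varword_lmul (u : word) (w : varword) : varword :=
  exist _ (embed_word u ++ val w) (is_varword_catl (embed_word u) (valP w)).

Definition varword_rmul (w : varword) (u : word) : varword :=
  exist _ (val w ++ embed_word u) (is_varword_catr (embed_word u) (valP w)).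

Definition preserving_hom (nu : varword -> word) :=
  [/\ {morph nu : v w / v * w},
      forall u w, nu (varword_lmul u w) = u * nu w &
      forall u w, nu (varword_rmul w u) = nu w * u].

Definition occurrences (j : 'I_n) (w : varword) : nat :=
  count_mem (inr j) (val w).

Definition P_set (k m : nat) (M : 'M[rat]_(k, m)) (F : set (varword -> word))
    (sigma : 'I_m -> 'I_n) : set (beta_pow posnat_semigroup k) :=
  [set p | forall (D : set word) (B : 'I_k -> set posnat),
     piecewise_syndetic D -> (forall i, ultra (p i) (B i)) ->
     exists w : varword,
       (forall nu, F nu -> D (nu w)) /\
       exists x : 'cV[posnat]_k,
         (M *m (\col_(j < m) (occurrences (sigma j) w)%:R))%R =
           map_mx posnat_rat x /\
         forall i, B i (x i ord0)].

End Words.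

(* Main.v *)
(* Let p be a minimal idempotent of beta N, D a piecewise syndetic set of words, e a minimal
   idempotent of beta S_0 and x a word with x^-1 D in e.

   Main tool (squeezed_idempotent): if e is an idempotent and Z is a closed subsemigroup with
   e Z and Z e contained in Z, then Z contains an idempotent w <= e. A homomorphism which maps e
   to a minimal idempotent q and w into the same semigroup then maps w to q as well.

   Image partition regularity yields an ultrafilter zeta on Q^m along which the entries of z and
   of M z are at least 1 and the entries of M z are coloured alike by every finite colouring; two
   entries of M z of the same order of magnitude along zeta are therefore asymptotically equal.
   Going through the orders of magnitude of the entries of z and M z, from the lowest to the
   highest, each order provides a rational vector v such that the entries of v and M v vanish at
   the lower orders, are positive at this order, and agree on the rows of M at this order. Squeezing along
   the image of p under y |-> y v produces an idempotent theta on N^m such that every row of M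
   maps theta to p.

   Squeezing once more, in beta (S_0 + S_n) and along e, gives an idempotent w which has weight
   theta and is mapped to e by every S_0-preserving homomorphism; the members of w contain the
   words to be found. *)
Require Import Defs.
From HB Require Import structures.
From mathcomp Require Import all_boot all_order all_algebra.
From mathcomp Require Import all_classical topology.
From mathcomp Require Import zify ring lra.

Set Implicit Arguments.
Unset Strict Implicit.
Unset Printing Implicit Defensive.

Import Order.TTheory GRing.Theory Num.Theory.

Local Open Scope classical_set_scope.
Local Open Scope group_scope.

(** * Ultrafilters and the right topological semigroup beta X *)

(** Zorn's lemma is applied to complements in [Z]; compactness keeps the intersection of a chain
    nonempty. [Q] stands for being a subsemigroup or a left ideal, both stable under
    intersections. *)
Lemma minimal_closed (T : topologicalType) (Q : set (set T)) (Z : set T) :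
  compact [set: T] -> closed Z -> Z !=set0 -> Q Z ->
  (forall F : set (set T), F `<=` Q -> Q (\bigcap_(A in F) A)) ->
  exists M, [/\ M `<=` Z, closed M, M !=set0, Q M &
    forall N, N `<=` M -> closed N -> N !=set0 -> Q N -> N = M].
Proof.
move=> cT clZ Z0 QZ QI.
pose good M := [/\ closed M, M !=set0, Q M & M `<=` Z].
pose P A := good (Z `\` A) /\ A `<=` Z.
have [F FP Ftot|A [[[clA A0 QA _] AZ] Amax]] := @Zorn_bigcup T P.
  have [[A0 FA0]|nF] := pselect (F !=set0); last first.
    rewrite (_ : F = set0) ?bigcup_set0; last by apply/seteqP; split => // A FA; case: nF; exists A.
    by split => //; rewrite setD0; split.
  split; last by move=> x [A FA]; apply: (FP _ FA).2.
  have ZFE : Z `\` \bigcup_(X in F) X = \bigcap_(B in [set Z `\` X | X in F]) B.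
    apply/seteqP; split=> [x [Zx nx] _ [X FX <-]|x xB].
      by split => // Xx; apply: nx; exists X.
    have [Zx _] : (Z `\` A0) x by apply: xB; exists A0.
    by split => // -[X FX Xx]; have [] : (Z `\` X) x by apply: xB; exists X.
  split; last by move=> x [].
  - rewrite ZFE; apply: closed_bigI => _ [X FX <-]; by have [[]] := FP _ FX.
  - have PF : ProperFilter (filter_from F (fun X => Z `\` X)).
      apply: filter_from_proper; last by move=> X FX; have [[]] := FP _ FX.
      apply: filter_from_filter; first by exists A0.
      move=> X Y FX FY; have [XY|YX] := Ftot _ _ FX FY.
        by exists Y => // x [Zx nY]; split; split => // /XY.
      by exists X => // x [Zx nY]; split; split => // /YX.
    have [|x [_ cx]] := cT _ PF; first by exists A0.
    exists x; rewrite ZFE => _ [X FX <-].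
    have [[clX _ _ _] _] := FP _ FX.
    by apply: clX => B xB; apply: cx => //; exists X.
  - by rewrite ZFE; apply: QI => _ [X FX <-]; have [[]] := FP _ FX.
exists (Z `\` A); split => // N NA clN N0 QN.
apply: contrapT => NnA; apply: (Amax (Z `\` N)); last first.
  have NZ : N `<=` Z by move=> x /NA[].
  split; last by move=> x [].
  by rewrite /good setDD (_ : Z `&` N = N) //; exact/setIidPr.
split=> [x Ax|sub].
  by split; [exact: AZ|move=> /NA[]].
apply: NnA; apply/seteqP; split => // x [Zx nAx].
by apply: contrapT => nNx; apply: nAx; apply: sub.
Qed.

(** * Topology of the space of ultrafilters *)

Section BetaTheory.
Variable X : Type.
Implicit Types (p q : beta X) (A B : set X).

Lemma beta_base_open A : open (beta_base A).
Proof.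
exists [set A] => //.
by rewrite bigcup_set1.
Qed.

Lemma beta_baseC A : beta_base (~` A) = ~` beta_base A.
Proof.
apply/seteqP; split=> p /=; rewrite /beta_base /=.
  by move=> pnA pA; have [x []] := filter_ex (filterI pA pnA).
by have [] := in_ultra_setVsetC A (ultraP p).
Qed.

Lemma beta_base_closed A : closed (beta_base A).
Proof. by rewrite -[A]setCK beta_baseC closedC; exact: beta_base_open. Qed.

Lemma beta_closed_sets (G : set_system X) :
  closed [set p | forall A, G A -> ultra p A].
Proof.
rewrite (_ : mkset _ = \bigcap_(A in G) beta_base A).
  by apply: closed_bigI => A _; exact: beta_base_closed.
by apply/seteqP; split => p pG A /pG.
Qed.

Lemma beta_nbhs p (B : set (beta X)) :
  nbhs p B -> exists2 A, ultra p A & beta_base A `<=` B.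
Proof.
rewrite nbhsE => -[C [[D _ <-] [A DA pA]] CB].
by exists A => // q qA; apply: CB; exists A.
Qed.

Lemma beta_compact : compact [set: beta X].
Proof.
rewrite compact_ultra => F FU _.
have uV : UltraFilter [set A | F (beta_base A)].
  apply: ultrafilter_setVsetC; last first.
    by move=> A; rewrite /= beta_baseC; exact: in_ultra_setVsetC.
  split.
    move=> /= F0; have [p] := filter_ex F0.
    by rewrite /beta_base /= => /filter_ex [].
  constructor=> /=.
  - by apply: (@filterE _ F) => p; exact: (@filterE _ (ultra p)).
  - by move=> A B; apply: (@filterS2 _ F) => p; exact: (@filterI _ (ultra p)).
  - by move=> A B AB; apply: (@filterS _ F) => p; exact: (@filterS _ (ultra p)).
exists (Beta uV); split => // B /beta_nbhs [A FA AB].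
exact: filterS AB FA.
Qed.

Lemma beta_eqP p q : (forall A, ultra p A -> ultra q A) -> p = q.
Proof.
move=> pq; apply: beta_inj; apply/esym/(@max_filter _ _ (ultraP p)) => //.
Qed.

Lemma beta_hausdorff : hausdorff_space (beta X).
Proof.
move=> p q pq; apply: beta_eqP => A pA.
have : closed (beta_base A) := @beta_base_closed A.
apply => B qB; apply: pq => //.
by apply: open_nbhs_nbhs; split => //; exact: beta_base_open.
Qed.

Lemma beta_closed_compact (Z : set (beta X)) : closed Z <-> compact Z.
Proof.
split=> [cZ|cZ]; first exact: subclosed_compact cZ beta_compact _.
exact: compact_closed beta_hausdorff cZ.
Qed.

Lemma ultra_finite (C : finType) (p : beta X) (c : X -> C) :
  exists a, ultra p [set x | c x = a].
Proof.
apply: contrapT => /forallNP na.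
have : ultra p [set x | forall a, ~ c x = a].
  have := @filter_forall X C (fun a => [set x | ~ c x = a]) (ultra p) _; apply => a.
  by have [/na|] := in_ultra_setVsetC [set x | c x = a] (ultraP p).
by move=> /filter_ex [x /(_ (c x))].
Qed.

End BetaTheory.

Section BetaMap.
Variables (X Y : Type) (f : X -> Y).

Lemma beta_map_ultra (p : beta X) : UltraFilter [set B | ultra p (f @^-1` B)].
Proof.
apply: ultrafilter_setVsetC; last first.
  by move=> B; exact: (in_ultra_setVsetC (f @^-1` B) (ultraP p)).
Qed.

Definition beta_map (p : beta X) : beta Y := Beta (beta_map_ultra p).

Lemma beta_map_fiber_closed (q : beta Y) : closed [set p | beta_map p = q].
Proof.
rewrite (_ : mkset _ = [set p | forall A, [set f @^-1` B | B in ultra q] A -> ultra p A]).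
  exact: beta_closed_sets.
apply/seteqP; split=> [p <- _ [B qB <-] //|p pq].
by apply/esym/beta_eqP => B qB; apply: pq; exists B.
Qed.

End BetaMap.

Lemma beta_map_comp X Y Z (f : X -> Y) (g : Y -> Z) (p : beta X) :
  beta_map g (beta_map f p) = beta_map (g \o f) p.
Proof. exact: beta_inj. Qed.

Lemma eq_beta_map X Y (f g : X -> Y) (p : beta X) :
  (\forall x \near ultra p, f x = g x) -> beta_map f p = beta_map g p.
Proof.
move=> fg; apply: beta_eqP => A; apply: (filterS2 _ _ fg) => x /=.
by move=> ->.
Qed.

Lemma beta_map_id X (f : X -> X) (p : beta X) :
  (\forall x \near ultra p, f x = x) -> beta_map f p = p.
Proof. by move=> /(@eq_beta_map X X f id) ->; exact: beta_inj. Qed.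

(** * Idempotents and minimal left ideals *)

Section BetaSemigroupTheory.
Variable X : semigroupType.
Implicit Types (p q e : beta X).

Lemma beta_mul_sets p q (A : set X) : ultra (p * q) A =
  (\forall x \near ultra p, \forall y \near ultra q, A (x * y)).
Proof. by []. Qed.

Lemma beta_mul_near p q (P : set X) :
  (\forall x \near ultra p, \forall y \near ultra q, P (x * y)) ->
  \forall x \near ultra (p * q), P x.
Proof. by []. Qed.

Lemma beta_mulr_continuous q : continuous (fun p : beta X => p * q).
Proof.
move=> p B /beta_nbhs [A pqA AB].
change (nbhs p ((fun r : beta X => r * q) @^-1` B)).
apply: (@filterS _ (nbhs p) _ (beta_base [set x | \forall y \near ultra q, A (x * y)])).
  by move=> r rA; exact: AB.
by apply: open_nbhs_nbhs; split => //; exact: beta_base_open.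
Qed.

Lemma beta_mulr_closed (Z : set (beta X)) q :
  closed Z -> closed [set p * q | p in Z].
Proof.
move=> cZ; apply/beta_closed_compact/continuous_compact.
  by apply: continuous_subspaceT; exact: beta_mulr_continuous.
exact/beta_closed_compact.
Qed.

Lemma beta_fiberr_closed q r : closed [set p : beta X | p * q = r].
Proof.
apply: (@preimage_closed _ _ (fun p => p * q) [set r]).
  by move=> p _; exact: beta_mulr_continuous.
by apply/beta_closed_compact; exact: compact_set1.
Qed.

Definition mul_closed (Z : set (beta X)) := forall p q, Z p -> Z q -> Z (p * q).

(** Ellis's lemma. For [e] in a minimal closed subsemigroup [M], [M e] is a closed subsemigroup of
    [M], so equals [M]; hence the fiber of [p * e = e] in [M] is nonempty, is all of [M] by
    minimality, and contains [e]. *)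
Lemma ellis (Z : set (beta X)) : closed Z -> Z !=set0 -> mul_closed Z ->
  exists2 e, Z e & e * e = e.
Proof.
move=> cZ Z0 mZ.
have [F FQ|M [MZ cM [e Me] mM Mmin]] := minimal_closed (@beta_compact X) cZ Z0 mZ.
  by move=> p q Fp Fq A FA; apply: (FQ _ FA); [exact: Fp|exact: Fq].
exists e; first exact: MZ.
have MeM : [set p * e | p in M] = M.
  apply: Mmin.
  - by move=> _ [p Mp <-]; exact: mM.
  - exact: beta_mulr_closed.
  - by exists (e * e), e.
  - move=> _ _ [p Mp <-] [q Mq <-]; exists (p * e * q); last by rewrite !mulgA.
    exact: mM (mM _ _ Mp Me) Mq.
have [f Mf fe] : [set p * e | p in M] e by rewrite MeM.
have MI : M `&` [set p | p * e = e] = M.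
  apply: Mmin.
  - by move=> p [].
  - by apply: closedI => //; exact: beta_fiberr_closed.
  - by exists f.
  - by move=> p q [Mp pe] [Mq qe]; split; [exact: mM|rewrite /= -mulgA qe pe].
by have [] : (M `&` [set p | p * e = e]) e by rewrite MI.
Qed.

(** Right translations are continuous, so Ellis's lemma applies to the closed subsemigroup [Z e]. It
    yields an idempotent [p e], and [e p e] is then an idempotent below [e]. *)
Lemma squeezed_idempotent (Z : set (beta X)) e : closed Z -> Z !=set0 ->
  mul_closed Z -> e * e = e ->
  (forall p, Z p -> Z (e * p) /\ Z (p * e)) ->
  exists w, [/\ Z w, w * w = w, e * w = w & w * e = w].
Proof.
move=> cZ [z Zz] mZ ee eZ.
have [||_ [p Zp <-] idem] := ellis (beta_mulr_closed (q := e) cZ).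
- by exists (z * e), z.
- move=> _ _ [p Zp <-] [q Zq <-]; exists (p * e * q); last by rewrite !mulgA.
  exact: mZ (eZ _ Zp).2 Zq.
have pe := (eZ _ Zp).2.
exists (e * (p * e)); split.
- by have [] := eZ _ pe.
- have H : p * e * e = p * e by rewrite -mulgA ee.
  by rewrite -mulgA [p * e * _]mulgA H idem.
- by rewrite mulgA ee.
- by rewrite -!mulgA ee.
Qed.

Definition left_ideal (L : set (beta X)) := forall p q, L q -> L (p * q).

Definition minimal_left_ideal (L : set (beta X)) :=
  [/\ closed L, L !=set0, left_ideal L &
      forall q, L q -> L `<=` [set p * q | p in setT]].

Lemma minimal_left_ideal_ex (r : beta X) :
  exists2 L, minimal_left_ideal L & L `<=` [set p * r | p in setT].
Proof.
have princl (q : beta X) : left_ideal [set p * q | p in setT].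
  by move=> p _ [s _ <-]; exists (p * s) => //; rewrite mulgA.
have [|F FQ|M [Mr cM M0 lM Mmin]] :=
    minimal_closed (@beta_compact X) (beta_mulr_closed (q := r) (@closedT _)) _ (princl r).
- by exists (r * r), r.
- by move=> p q Fq A FA; apply: (FQ _ FA); exact: Fq.
exists M => //; split => // q Mq.
rewrite (Mmin [set p * q | p in setT]) //.
- by move=> _ [p _ <-]; exact: lM.
- by apply: beta_mulr_closed; exact: closedT.
- by exists (q * q), q.
Qed.

Lemma minimal_left_ideal_mulr L q : minimal_left_ideal L ->
  minimal_left_ideal [set p * q | p in L].
Proof.
move=> [cL [l Ll] lL Lmin]; split.
- exact: beta_mulr_closed.
- by exists (l * q), l.
- by move=> p _ [s Ls <-]; exists (p * s); [exact: lL|rewrite mulgA].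
- move=> _ [s Ls <-] _ [t Lt <-]; have [u _ <-] := Lmin _ Ls _ Lt.
  by exists u => //; rewrite mulgA.
Qed.

Lemma minimal_left_ideal_sub L I : minimal_left_ideal L -> @ideal (beta X) I -> L `<=` I.
Proof.
move=> [cL [l Ll] lL Lmin] [[x Ix] Iid] p Lp.
have [u _ <-] := Lmin _ (lL x _ Ll) _ Lp.
by apply: (Iid _ _ _).2; apply: (Iid _ _ _).1.
Qed.

(** The union of the minimal left ideals is a two-sided ideal, as their right translates are again
    minimal left ideals. *)
Lemma smallest_ideal_left p : @smallest_ideal (beta X) p ->
  exists2 L, minimal_left_ideal L & L p.
Proof.
move=> Kp; pose I := \bigcup_(L in minimal_left_ideal) L.
suff idI : @ideal (beta X) I by have [L ? ?] := Kp _ idI; exists L.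
split.
  have [L mL _] := minimal_left_ideal_ex p.
  by have [_ [l Ll] _ _] := mL; exists l, L.
move=> x y [L mL Lx]; split.
  exists [set p * y | p in L]; last by exists x.
  exact: minimal_left_ideal_mulr.
by exists L => //; have [_ _ lL _] := mL; exact: lL.
Qed.

(** [f] lies in a minimal left ideal containing [e], so [e = x f]; then [e f = e], while
    [e f = f]. *)
Lemma minimal_idempotent_le e f : @minimal_idempotent (beta X) e ->
  f * f = f -> e * f = f -> f * e = f -> f = e.
Proof.
move=> [/smallest_ideal_left [L [_ _ lL Lmin] Le] ee] ff ef fe.
have Lf : L f by rewrite -fe; exact: lL.
have [x _ xf] := Lmin _ Lf _ Le.
by rewrite -ef -xf -mulgA ff.
Qed.

Lemma left_ideal_idempotent L : minimal_left_ideal L ->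
  exists2 e, L e & @minimal_idempotent (beta X) e.
Proof.
move=> mL; have [cL L0 lL _] := mL.
have [|e Le ee] := ellis cL L0; first by move=> p q _; exact: lL.
by exists e => //; split => // I /(minimal_left_ideal_sub mL); exact.
Qed.

Lemma minimal_idempotent_ex (p : beta X) : exists e, @minimal_idempotent (beta X) e.
Proof.
have [L mL _] := minimal_left_ideal_ex p.
by have [e _ ?] := left_ideal_idempotent mL; exists e.
Qed.

(** With [e] an idempotent in a minimal left ideal containing [p], one has [p = q e], hence
    [p e = p]; membership of [D] in [p e] provides [x]. *)
Lemma piecewise_syndetic_idempotent (D : set X) : piecewise_syndetic D ->
  exists x e, @minimal_idempotent (beta X) e /\ \forall y \near ultra e, D (x * y).
Proof.
move=> [p /smallest_ideal_left [L mL Lp] pD].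
have [e Le me] := left_ideal_idempotent mL.
have [_ _ _ /(_ _ Le _ Lp) [q _ qe]] := mL.
have pe : p * e = p by rewrite -qe -mulgA me.2.
move: pD; rewrite -pe beta_mul_sets => /filter_ex [x xD].
by exists x, e.
Qed.

End BetaSemigroupTheory.

Section BetaMorph.
Variables (X Y : semigroupType) (f : X -> Y).
Hypothesis fM : {morph f : x y / x * y}.

Lemma beta_mapM : {morph beta_map f : p q / p * q}.
Proof.
move=> p q; apply: beta_eqP => A /=; rewrite /beta_mul_val /=.
by apply: filterS => x; apply: filterS => y /=; rewrite fM.
Qed.

Lemma beta_fiber_mul_closed (q : beta Y) : q * q = q ->
  mul_closed [set p | beta_map f p = q].
Proof. by move=> qq p r /= pq rq; rewrite beta_mapM pq rq. Qed.

(** Minimality of [e] is available in [beta X], so [q], which is concentrated on the range of [f],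
    is pulled back there; [beta_map f] is injective and reflects the relations. *)
Lemma minimal_idempotent_below_map (e : beta X) (q : beta Y) (r : Y -> X) :
  cancel f r -> @minimal_idempotent (beta X) e ->
  ultra q (range f) -> q * q = q ->
  beta_map f e * q = q -> q * beta_map f e = q -> q = beta_map f e.
Proof.
move=> fK me qf qq eq qe.
have injf : injective (beta_map f).
  apply: (can_inj (g := beta_map r)) => p.
  by rewrite beta_map_comp beta_map_id //; apply: filterE => x; exact: fK.
pose q' := beta_map r q.
have fq' : beta_map f q' = q.
  rewrite beta_map_comp beta_map_id //; apply: filterS qf => _ [x _ <-] /=.
  by rewrite fK.
suff -> : e = q' by [].
by apply/esym/minimal_idempotent_le => //; apply: injf; rewrite beta_mapM fq'.
Qed.

End BetaMorph.
(** * Image partition regular matrices *)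

Section PosnatIdempotents.
Variable p : beta posnat_semigroup.
Hypothesis pp : p * p = p.

(** The residue [a] modulo [d] is constant on a member of [p], and [p * p = p] forces
    [a + a = a]. *)
Lemma idempotent_dvdn (d : nat) : (0 < d)%N -> \forall y \near ultra p, (d %| val y)%N.
Proof.
case: d => // d _.
have [a pa] := ultra_finite p (fun y : posnat => inord (val y %% d.+1) : 'I_d.+1).
have {}pa : \forall y \near ultra p, (val y = a %[mod d.+1])%N.
  apply: filterS pa => y <-.
  by rewrite inordK ?modn_mod // ltn_mod.
have : \forall x \near ultra p, \forall y \near ultra p, (val x + val y = a %[mod d.+1])%N.
  by rewrite -{1}pp in pa.
move=> /(filterI pa) /filter_ex [x [xa /(filterI pa) /filter_ex [y [ya xya]]]].
have a0 : (a = 0 %[mod d.+1])%N.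
  apply/eqP; rewrite -(eqn_modDl a) addn0; apply/eqP.
  by rewrite -modnDm -{1}xa -{1}ya modnDm.
by apply: filterS pa => z za; rewrite /dvdn za a0 mod0n.
Qed.

Lemma idempotent_gt (c : rat) : \forall y \near ultra p, (c < posnat_rat y)%R.
Proof.
have [N cN] : exists N : nat, (c < N%:R)%R.
  by eexists; apply: le_lt_trans (ler_norm _) (archi_boundP (normr_ge0 c)).
apply: filterS (idempotent_dvdn (ltn0Sn N)) => y Ny.
apply: lt_trans cN _; rewrite ltr_nat.
by apply: leq_trans (dvdn_leq _ Ny) => //; exact: (valP y).
Qed.

End PosnatIdempotents.

(** * Rational estimates and comparison of growth along a filter *)

Local Open Scope ring_scope.

Lemma expr_unbounded (b c : rat) : 1 < b -> exists n, c < b ^+ n.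
Proof.
move=> b1.
have be n : 1 + n%:R * (b - 1) <= b ^+ n.
  elim: n => [|n IH]; first by rewrite mul0r addr0 expr0.
  rewrite exprS -natr1.
  have : b * (1 + n%:R * (b - 1)) <= b * b ^+ n by rewrite ler_wpM2l //; lra.
  have : 0 <= n%:R * ((b - 1) * (b - 1)) by rewrite mulr_ge0 // mulr_ge0 //; lra.
  lra.
have [n cn] : exists n : nat, `|c| / (b - 1) < n%:R.
  by eexists; apply: archi_boundP; rewrite divr_ge0 // subr_ge0 ltW.
exists n; apply: lt_le_trans (be n).
move: cn; rewrite ltr_pdivrMr ?subr_gt0 // => cn.
have := ler_norm c; lra.
Qed.

Lemma posnat_ratD (x y : posnat) : posnat_rat (posnat_add x y) = posnat_rat x + posnat_rat y.
Proof. by rewrite /posnat_rat natrD. Qed.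

Lemma posnat_ratM :
  {morph (posnat_rat : posnat_semigroup -> Algebra.to_multiplicative rat) : x y / (x * y)%g}.
Proof. exact: posnat_ratD. Qed.

Lemma posnat_rat_gt0 x : 0 < posnat_rat x.
Proof. by rewrite /posnat_rat ltr0n; case: x. Qed.

Lemma posnat_rat_inj : injective posnat_rat.
Proof. by move=> x y /eqP; rewrite eqr_nat => /eqP /val_inj. Qed.

Lemma posnat_ratP (x : rat) : x \is a Num.int -> 0 < x -> exists y, x = posnat_rat y.
Proof.
move=> xZ x0; have /natrP [n xn] : x \is a Num.nat by rewrite natrEint xZ ltW.
have n0 : (0 < n)%N by rewrite xn ltr0n in x0.
by exists (exist _ n n0).
Qed.

Lemma posnat_rat_retraction : exists rho : rat -> posnat, cancel posnat_rat rho.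
Proof.
have ex (q : rat) : exists y : posnat, (exists z, q = posnat_rat z) -> q = posnat_rat y.
  have [[y ->]|ny] := pselect (exists y, q = posnat_rat y); first by exists y.
  by exists (exist _ 1%N isT).
have [rho rhoP] := choice ex.
by exists rho => y; apply/posnat_rat_inj/esym/rhoP; exists y.
Qed.

Lemma eq_of_close_mod (s t L : nat) : (s < L + t.+1)%N -> (t < L + s.+1)%N ->
  (s = t %[mod L.+1])%N -> s = t.
Proof.
wlog st : s t / (s <= t)%N => [hw st ts e|_ ts e].
  by have [/hw|/ltnW /hw h] := leqP s t; [exact|apply/esym/h].
have : (L.+1 %| t - s)%N by rewrite -eqn_mod_dvd //; apply/eqP.
have [/eqP|ts0 /dvdn_leq] := posnP (t - s)%N; [lia|move=> /(_ ts0); lia].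
Qed.

(* Colouring by the integer part of log_(1+eps) modulo a large L: two comparable quantities which
   always get the same colour have the same integer part of the logarithm. *)
Lemma comparable_close (X : Type) (F : set_system X) (u v : X -> rat) (a eps : rat) :
  Filter F ->
  (forall (C : finType) (c : rat -> C), \forall x \near F, c (u x) = c (v x)) ->
  (\forall x \near F, 1 <= u x) -> (\forall x \near F, 1 <= v x) ->
  (\forall x \near F, u x <= a * v x) -> (\forall x \near F, v x <= a * u x) ->
  0 < eps -> \forall x \near F, u x - v x <= eps * v x.
Proof.
move=> FF cuv u1 v1 uv vu eps0; pose b := 1 + eps.
have b1 : 1 < b by rewrite /b; lra.
have logP (x : rat) : exists n, 1 <= x -> b ^+ n <= x < b ^+ n.+1.
  have [x1|/negP nx1] := boolP (1 <= x); last by exists 0%N.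
  have [n xn] := expr_unbounded x b1.
  have exn : exists n, x < b ^+ n by exists n.
  case: (ex_minnP exn) => -[|l] xl lmin.
    by rewrite expr0 in xl; lra.
  exists l => _; rewrite xl andbT leNgt; apply/negP => /lmin.
  by rewrite ltnn.
have [f fP] := choice logP.
(* [L] bounds how many powers of [b] the ratio [a] can span, so the two logarithms differ by at most
   [L]. *)
have [L aL] := expr_unbounded a b1.
near=> x.
have xu : 1 <= u x by near: x.
have xv : 1 <= v x by near: x.
have /andP[fu fu'] := fP _ xu; have /andP[fv fv'] := fP _ xv.
have xuv : u x <= a * v x by near: x.
have xvu : v x <= a * u x by near: x.
have clog (y z : rat) : 1 <= z -> b ^+ (f y) <= y -> z < b ^+ (f z).+1 -> y <= a * z ->
    (f y < L + (f z).+1)%N.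
  move=> z1 fy fz yz; rewrite -(ltr_eXn2l b1).
  apply: le_lt_trans fy _; apply: le_lt_trans yz _.
  rewrite exprD; apply: (@le_lt_trans _ _ (b ^+ L * z)).
    by rewrite ler_wpM2r ?ltW //; lra.
  by rewrite ltr_pM2l // exprn_gt0; lra.
have e : inord (f (u x) %% L.+1) = inord (f (v x) %% L.+1) :> 'I_L.+1.
  by near: x; exact: (cuv _ (fun y => inord (f y %% L.+1) : 'I_L.+1)).
have {}e : (f (u x) = f (v x) %[mod L.+1])%N.
  by move/(congr1 val): e; rewrite /= !inordK // ltn_mod.
have ef : f (u x) = f (v x).
  exact: eq_of_close_mod (clog _ _ xv fu fv' xuv) (clog _ _ xu fv fu' xvu) e.
rewrite ef exprS in fu'.
have : b * b ^+ f (v x) <= b * v x by rewrite ler_wpM2l //; lra.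
rewrite /b in fu' *; lra.
Unshelve. all: by end_near.
Qed.

(** * A rational vector attached to one order of magnitude *)

Section ClassVector.
Variables (r m : nat) (G : 'M[rat]_(r, m)) (K Low C : {set 'I_r}) (s0 : 'I_r).
Variable F : set_system 'cV[rat]_m.
Hypothesis FF : ProperFilter F.
Hypothesis LowC : forall s, s \in Low -> s \notin C.
Let y (z : 'cV[rat]_m) s := (G *m z) s ord0.
Hypothesis y0 : \forall z \near F, 0 < y z s0.
Hypothesis yLow : forall s eps, s \in Low -> 0 < eps ->
  \forall z \near F, `|y z s| <= eps * y z s0.
Hypothesis yC : forall s, s \in C -> exists2 a, 0 < a & \forall z \near F, y z s0 <= a * y z s.
Hypothesis yCK : forall s t eps, s \in C :&: K -> t \in C :&: K -> 0 < eps ->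
  \forall z \near F, `|y z s - y z t| <= eps * y z s0.

(* The conditions to be met are vanishing conditions H *m v = 0. Along F, the defect H *m z is
   negligible, and z is corrected by a generalised inverse of H. *)
Lemma class_vector : exists v : 'cV[rat]_m,
  [/\ forall s, s \in Low -> (G *m v) s ord0 = 0,
      forall s, s \in C -> 0 < (G *m v) s ord0 &
      forall s t, s \in C :&: K -> t \in C :&: K -> (G *m v) s ord0 = (G *m v) t ord0].
Proof.
(* A reference row; the default [s0] occurs only when [C :&: K] is empty, and then no row is
   compared with it. *)
pose t0 := odflt s0 [pick t in C :&: K].
have t0P s : s \in C :&: K -> t0 \in C :&: K.
  by rewrite /t0; case: pickP => //= none; rewrite none.
pose H : 'M[rat]_(r, m) := \matrix_(s, j)
  (if s \in Low then G s j else if s \in C :&: K then G s j - G t0 j else 0).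
have HE z s : (H *m z) s ord0 =
    if s \in Low then y z s else if s \in C :&: K then y z s - y z t0 else 0.
  rewrite /y !mxE; case: ifPn => sL.
    by apply: eq_bigr => j _; rewrite mxE sL.
  case: ifPn => sC.
    by rewrite -sumrB; apply: eq_bigr => j _; rewrite mxE (negbTE sL) sC mulrBl.
  by apply: big1 => j _; rewrite mxE (negbTE sL) (negbTE sC) mul0r.
have Hsmall s eps : 0 < eps -> \forall z \near F, `|(H *m z) s ord0| <= eps * y z s0.
  move=> e0; have := @yLow s _ _ e0; have := fun h1 h2 => @yCK s t0 _ h1 h2 e0.
  case: (boolP (s \in Low)) => sL.
    by move=> _ /(_ isT); apply: filterS => z; rewrite HE sL.
  case: (boolP (s \in C :&: K)) => sC.
    by move=> /(_ isT (t0P _ sC)) + _; apply: filterS => z; rewrite HE (negbTE sL) sC.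
  move=> _ _; apply: filterS y0 => z z0.
  by rewrite HE (negbTE sL) (negbTE sC) normr0 mulr_ge0 ?ltW.
pose P := pinvmx H.
pose v (z : 'cV[rat]_m) := z - P *m (H *m z).
have Hv z : H *m v z = 0.
  have HPH : H *m P *m H = H by rewrite mulmxKpV.
  by rewrite /v mulmxBr mulmxA [_ *m (H *m z)]mulmxA HPH subrr.
have vpos s : s \in C -> \forall z \near F, 0 < (G *m v z) s ord0.
  move=> /yC [a a0 ya].
  (* [B] exceeds the absolute row sum of [G *m P]; with defects at most [y z s0 / (2 a B)] the
     correction is smaller than [y z s0 / a], hence than [y z s]. *)
  pose B := 1 + \sum_t `|(G *m P) s t|.
  have B0 : 0 < B by rewrite ltr_pwDl ?ltr01 // sumr_ge0.
  have e0 : 0 < (2%:R * a * B)^-1 by rewrite invr_gt0 !mulr_gt0.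
  have small := filter_forall _ (fun t => Hsmall t _ e0).
  near=> z.
  have z0 : 0 < y z s0 by near: z.
  have za : y z s0 <= a * y z s by near: z.
  have zs : forall t, `|(H *m z) t ord0| <= (2%:R * a * B)^-1 * y z s0 by near: z; exact: small.
  have -> : (G *m v z) s ord0 = y z s - (G *m P *m (H *m z)) s ord0.
    by rewrite /v mulmxBr [LHS]mxE [X in _ + X]mxE [G *m (P *m _)]mulmxA.
  rewrite subr_gt0; apply: le_lt_trans (ler_norm _) _.
  have : `|(G *m P *m (H *m z)) s ord0| <= (B - 1) * ((2%:R * a * B)^-1 * y z s0).
    rewrite mxE; apply: le_trans (ler_norm_sum _ _ _) _.
    rewrite /B addrC addKr mulr_suml; apply: ler_sum => t _.
    by rewrite normrM ler_wpM2l.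
  move=> /le_lt_trans; apply.
  rewrite -(ltr_pM2l a0); apply: lt_le_trans za.
  rewrite (_ : a * _ = (B - 1) / (2%:R * B) * y z s0); last by field; rewrite !gt_eqF.
  rewrite gtr_pMl // ltr_pdivrMr ?mulr_gt0 //; lra.
have vposC s : \forall z \near F, s \in C -> 0 < (G *m v z) s ord0.
  have [sC|] := boolP (s \in C); first by apply: filterS (vpos _ sC).
  by move=> _; apply: filterE.
have [z zC] := filter_ex (filter_forall _ vposC).
have Hv0 s : (H *m v z) s ord0 = 0 by rewrite Hv mxE.
exists (v z); split => // [s sL|s t sC tC].
  by have := Hv0 s; rewrite HE sL.
suff eq0 u : u \in C :&: K -> (G *m v z) u ord0 = (G *m v z) t0 ord0 by rewrite !eq0.
move=> uC; have := Hv0 u; rewrite HE uC ifN; first by move/eqP; rewrite subr_eq0 => /eqP.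
by apply: contraL uC => /LowC uC; rewrite inE (negbTE uC).
Unshelve. all: by end_near.
Qed.

End ClassVector.
Definition principal (X : Type) (x : X) : beta X := Beta (principal_filter_ultra x).

(** * Extending an idempotent to the next order of magnitude *)

Section Extension.
Variables (r m : nat) (G : 'M[rat]_(r, m)) (K : {set 'I_r}).
Variable p : beta posnat_semigroup.
Hypothesis mp : @minimal_idempotent (beta posnat_semigroup) p.
Local Notation Qm := (Algebra.to_multiplicative 'cV[rat]_m).
Local Notation Q1 := (Algebra.to_multiplicative rat).
Let l s (z : 'cV[rat]_m) : rat := (G *m z) s ord0.
Let L s : Qm -> Q1 := l s.

Let lD s (x y : 'cV[rat]_m) : l s (x + y) = l s x + l s y.
Proof. by rewrite /l mulmxDr mxE. Qed.

Let lZ s (a : rat) (x : 'cV[rat]_m) : l s (a *: x) = a * l s x.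
Proof. by rewrite /l -scalemxAr mxE. Qed.

Let lM s : {morph L s : x y / (x * y)%g}.
Proof. exact: lD. Qed.

(** [S] collects the rows already treated, [K] the rows to be sent to [p]. Integrality is required
    of all rows, so that it is at hand when a row joins [S]. *)
Definition solves (S : {set 'I_r}) (z : beta Qm) :=
  [/\ (z * z)%g = z,
      forall s, \forall x \near ultra z, l s x \is a Num.int,
      forall s, s \in S -> \forall x \near ultra z, 0 < l s x &
      forall s, s \in S -> s \in K -> beta_map (L s) z = beta_map posnat_rat p].

Lemma solves0 : exists z, solves finset.set0 z.
Proof.
exists (principal 0); split => [|s|s|s]; rewrite ?inE //.
- apply: beta_eqP => A /principal_filterP /principal_filterP A0.
  by apply/principal_filterP; rewrite -(addr0 0).
- by apply/principal_filterP; rewrite /l mulmx0 mxE.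
Qed.

(** Squeezing along the image [d] of [p] under [y |-> y w]: rows in [S] vanish on [d], so the
    conditions on them survive multiplication by [d]; rows in [C :&: K] send [d] to [p], hence an
    idempotent below [d] to one below [p]. *)
Lemma solves_step (S C : {set 'I_r}) (v : 'cV[rat]_m) (z0 : beta Qm) :
  solves S z0 -> (forall s, s \in S -> l s v = 0) ->
  (forall s, s \in C -> 0 < l s v) ->
  (forall s t, s \in C :&: K -> t \in C :&: K -> l s v = l t v) ->
  exists z, solves (S :|: C) z.
Proof.
move=> [z0z0 z0Z z0pos z0p] vS vC vK.
(* [v] is scaled to take the value 1 on [C :&: K], so that these rows map [d] exactly to [p]. *)
have [w [wS wC wK]] : exists w, [/\ forall s, s \in S -> l s w = 0,
    forall s, s \in C -> 0 < l s w & forall s, s \in C :&: K -> l s w = 1].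
  have [t tC|CK0] := pickP (mem (C :&: K)); last first.
    by exists v; split => // s sC; have := CK0 s; rewrite /= sC.
  have t0 : 0 < l t v by apply: vC; move: tC; rewrite /= !inE => /andP[].
  exists ((l t v)^-1 *: v); split=> s sS; rewrite lZ.
  - by rewrite (vS _ sS) mulr0.
  - by rewrite mulr_gt0 ?invr_gt0 // vC.
  - by rewrite (vK s t) // mulVf // gt_eqF.
have pp := mp.2.
pose f (y : posnat_semigroup) : Qm := posnat_rat y *: w.
have fM : {morph f : x y / (x * y)%g}.
  by move=> x y; rewrite /f (posnat_ratM x y); exact: scalerDl.
have lf s y : l s (f y) = posnat_rat y * l s w by rewrite /f lZ.
pose d := beta_map f p.
have dd : (d * d)%g = d by rewrite -(beta_mapM fM) pp.
have dZ s : \forall x \near ultra d, l s x \is a Num.int.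
  (* Clearing denominators: [p] contains the multiples of the denominator of [l s w]. *)
  rewrite /d /=; pose n := `|denq (l s w)|%N.
  have n0 : (0 < n)%N by rewrite absz_gt0 denq_neq0.
  apply: filterS (idempotent_dvdn pp n0) => y /dvdnP [q yq] /=.
  rewrite lf /posnat_rat yq natrM -mulrA.
  have -> : n%:R * l s w = (numq (l s w))%:~R.
    by rewrite numqE mulrC /n -[in RHS]absz_denq.
  by rewrite rpredM ?intr_int // natr_int.
have dS s : s \in S -> \forall x \near ultra d, l s x = 0.
  by move=> sS; apply: (@filterE _ (ultra p)) => y /=; rewrite lf wS // mulr0.
pose Z : set (beta Qm) := [set z | [/\ forall s, \forall x \near ultra z, l s x \is a Num.int,
      forall s, s \in S -> \forall x \near ultra z, 0 < l s x &
      forall s, s \in S -> s \in K -> beta_map (L s) z = beta_map posnat_rat p]].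
have cZ : closed Z.
  rewrite (_ : Z = (\bigcap_s beta_base [set x | l s x \is a Num.int]) `&`
      (\bigcap_(s in [set` S]) beta_base [set x | 0 < l s x]) `&`
      (\bigcap_(s in [set s | s \in S /\ s \in K])
        [set z | beta_map (L s) z = beta_map posnat_rat p])).
    apply: closedI; first apply: closedI.
    - by apply: closed_bigI => s _; exact: beta_base_closed.
    - by apply: closed_bigI => s _; exact: beta_base_closed.
    - by apply: closed_bigI => s _; exact: beta_map_fiber_closed.
  apply/seteqP; split => z.
    by move=> [zZ zS zK]; split; [split=> s sS; [exact: zZ|exact: zS]|move=> s [sS sK]; exact: zK].
  move=> [[zZ zS] zK]; split => [s|s sS|s sS sK].
  - exact: zZ.
  - exact: zS.
  - exact: zK.
have Zint (z z' : beta Qm) : (forall s, \forall x \near ultra z, l s x \is a Num.int) ->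
    (forall s, \forall x \near ultra z', l s x \is a Num.int) ->
    forall s, \forall x \near ultra (z * z')%g, l s x \is a Num.int.
  move=> zZ zZ' s; apply: beta_mul_near; apply: filterS (zZ s) => x xZ.
  by apply: filterS (zZ' s) => y yZ; rewrite lD rpredD.
have mZ : mul_closed Z.
  move=> z z' [zZ zS zK] [zZ' zS' zK']; split; first exact: Zint.
    move=> s sS; apply: beta_mul_near; apply: filterS (zS s sS) => x x0.
    by apply: filterS (zS' s sS) => y y0; rewrite lD addr_gt0.
  by move=> s sS sK; rewrite (beta_mapM (lM s)) zK // zK' // -(beta_mapM posnat_ratM) pp.
have dZZ z : Z z -> Z (d * z)%g /\ Z (z * d)%g.
  move=> [zZ zS zK]; split; split; [exact: Zint| | |exact: Zint| |].
  - move=> s sS; apply: (@beta_mul_near _ d z); apply: filterS (dS s sS) => x x0.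
    by apply: filterS (zS s sS) => y y0; rewrite lD x0 add0r.
  - move=> s sS sK; rewrite -(zK s sS sK); apply/esym/beta_eqP => A zA.
    have {}zA : \forall y \near ultra z, A (l s y) by exact: zA.
    apply: (@beta_mul_near _ d z (L s @^-1` A)); apply: filterS (dS s sS) => x x0.
    by apply: filterS zA => y; rewrite /L /= lD x0 add0r.
  - move=> s sS; apply: (@beta_mul_near _ z d); apply: filterS (zS s sS) => x x0.
    by apply: filterS (dS s sS) => y y0; rewrite lD y0 addr0.
  - move=> s sS sK; rewrite -(zK s sS sK); apply/esym/beta_eqP => A zA.
    have {}zA : \forall y \near ultra z, A (l s y) by exact: zA.
    apply: (@beta_mul_near _ z d (L s @^-1` A)); apply: filterS zA => x xA.
    by apply: filterS (dS s sS) => y y0; rewrite /L /= lD y0 addr0.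
have [|z [[zZ zS zK] zz dz zd]] := squeezed_idempotent cZ _ mZ dd dZZ.
  by exists z0; split.
(* Since [z = d z d], a typical element is [x + u + y w], where [y] is chosen last and large enough
   to outweigh [x] and [u]. *)
have zC s : s \in C -> \forall x \near ultra z, 0 < l s x.
  move=> sC; rewrite -dz -zd; apply: (@beta_mul_near _ d); apply: filterE => x.
  apply: (@beta_mul_near _ z d (fun u => 0 < L s (x * u)%g)); apply: filterE => u.
  suff : \forall y \near ultra p, 0 < L s (x * (u * f y))%g by [].
  apply: filterS (idempotent_gt pp (- (l s x + l s u) / l s w)) => y.
  have -> : L s (x * (u * f y))%g = l s x + l s u + posnat_rat y * l s w.
    by rewrite -lf -addrA -!lD.
  by rewrite ltr_pdivrMr ?wC //; lra.
exists z; split => // s; rewrite inE => /orP[sS|sC].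
- exact: zS.
- exact: zC.
- exact: zK.
move=> sK; have sCK : s \in C :&: K by rewrite inE sC.
have ld : beta_map (L s) d = beta_map posnat_rat p.
  rewrite beta_map_comp; apply: eq_beta_map; apply: (@filterE _ (ultra p)) => y.
  by have := lf s y; rewrite wK // mulr1.
have [rho rhoK] := posnat_rat_retraction.
apply: (minimal_idempotent_below_map posnat_ratM rhoK mp).
- rewrite /=; apply: (filterS2 _ _ (zZ s) (zC s sC)) => x xZ x0.
  by have [y e] := posnat_ratP xZ x0; exists y; last exact: esym e.
- by rewrite -(beta_mapM (lM s)) zz.
- by rewrite -ld -(beta_mapM (lM s)) dz.
- by rewrite -ld -(beta_mapM (lM s)) zd.
Qed.

End Extension.

(** * Going through the orders of magnitude *)

Section MonochromaticUltrafilter.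
Variables (r m : nat) (G : 'M[rat]_(r, m)) (K : {set 'I_r}) (zeta : beta 'cV[rat]_m).
Let y (z : 'cV[rat]_m) s := (G *m z) s ord0.
Hypothesis y1 : forall s, \forall z \near ultra zeta, 1 <= y z s.
Hypothesis yK : forall s t (C : finType) (c : rat -> C), s \in K -> t \in K ->
  \forall z \near ultra zeta, c (y z s) = c (y z t).

Let y_gt0 s : \forall z \near ultra zeta, 0 < y z s.
Proof. by apply: filterS (y1 s) => z; apply: lt_le_trans. Qed.

(** A union of lowest orders of magnitude along [zeta]. *)
Let down (S : {set 'I_r}) := forall s t eps, s \in S -> t \notin S -> 0 < eps ->
  \forall z \near ultra zeta, y z s <= eps * y z t.

(** [s0] is a smallest row outside [S] and [C] its order of magnitude. Rows of [C :&: K] are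
    comparable and coloured alike, hence asymptotically equal, as [class_vector] requires. *)
Lemma lowest_class (S : {set 'I_r}) : down S -> S != [set: 'I_r]%SET ->
  exists (C : {set 'I_r}) (v : 'cV[rat]_m),
  [/\ down (S :|: C), (#|S| < #|S :|: C|)%N,
      forall s, s \in S -> y v s = 0,
      forall s, s \in C -> 0 < y v s &
      forall s t, s \in C :&: K -> t \in C :&: K -> y v s = y v t].
Proof.
move=> dS ST.
have [t0 t0S] : exists t0, t0 \notin S.
  apply/existsP; rewrite -negb_forall; apply: contra ST => /forallP allS.
  by apply/eqP/setP => s; rewrite allS inE.
have [s0 s0min] := ultra_finite zeta (fun z => [arg min_(s < t0 | s \notin S) y z s]%O).
have {s0min} [s0S s0min] : s0 \notin S /\ forall t, t \notin S ->
    \forall z \near ultra zeta, y z s0 <= y z t.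
  split=> [|t tS].
    by have [z <-] := filter_ex s0min; case: Order.TotalTheory.arg_minP.
  by apply: filterS s0min => z <-; case: Order.TotalTheory.arg_minP => // s _; apply.
pose C := [set t | (t \notin S) &&
  `[< exists2 a, 0 < a & \forall z \near ultra zeta, y z t <= a * y z s0 >] ]%SET.
have CP t : t \in C -> t \notin S /\
    exists2 a, 0 < a & \forall z \near ultra zeta, y z t <= a * y z s0.
  by rewrite inE => /andP[? /asboolP].
have s0C : s0 \in C.
  rewrite inE s0S; apply/asboolP; exists 1 => //.
  by apply: filterE => z; rewrite mul1r.
exists C.
have [|s eps sS e0|s sC|s t eps|v [vS vC vK]] :=
    @class_vector _ _ G K S C s0 (ultra zeta) _ _ (y_gt0 s0).
- by move=> s sS; apply/negP => /CP []; rewrite sS.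
- apply: filterS2 (y_gt0 s) (dS _ _ _ sS s0S e0) => z z0.
  by rewrite ger0_norm // ltW.
- exists 1 => //; apply: filterS (s0min s (CP _ sC).1) => z.
  by rewrite mul1r.
- have close u v eps' : u \in C :&: K -> v \in C :&: K -> 0 < eps' ->
      \forall z \near ultra zeta, y z u - y z v <= eps' * y z s0.
    move=> /finset.setIP[uC uK] /finset.setIP[vC vK] e0.
    have [[uS [a a0 ua]] [vS [b b0 vb]]] := (CP _ uC, CP _ vC).
    (* The sum [d + d'] gives the same constant in both directions, as [comparable_close]
       demands. *)
    have comparable w w' d d' : w' \notin S -> 0 < d -> 0 < d' ->
        (\forall z \near ultra zeta, y z w <= d * y z s0) ->
        \forall z \near ultra zeta, y z w <= (d + d') * y z w'.
      move=> w'S d0 d'0 wd; near=> z.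
      have zw : y z w <= d * y z s0 by near: z.
      have s0w' : y z s0 <= y z w' by near: z; exact: s0min.
      have z0 : 0 < y z s0 by near: z; exact: y_gt0.
      apply: le_trans zw _; apply: (@le_trans _ _ ((d + d') * y z s0)).
        by rewrite ler_pM2r // lerDl ltW.
      by rewrite ler_pM2l // addr_gt0.
    have uv := comparable u v a b vS a0 b0 ua.
    have vu := comparable v u b a uS b0 a0 vb; rewrite addrC in vu.
    have e'0 : 0 < eps' / b by rewrite divr_gt0.
    have cl : \forall z \near ultra zeta, y z u - y z v <= eps' / b * y z v.
      exact: comparable_close (fun C c => yK c uK vK) (y1 u) (y1 v) uv vu e'0.
    apply: filterS2 vb cl => z zv /le_trans; apply.
    rewrite -(ler_pM2l (_ : 0 < eps' / b)) // in zv.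
    by apply: le_trans zv _; rewrite mulrA divfK // gt_eqF.
  move=> sC tC e0; apply: filterS2 (close _ _ _ sC tC e0) (close _ _ _ tC sC e0) => z h1 h2.
  by rewrite ler_norml h1 andbT lerNl opprB.
exists v; split => //.
- move=> s t eps /finset.setUP sSC; rewrite finset.in_setU negb_or => /andP[tS tC] e0.
  have [sS|sC] := sSC; first exact: dS.
  have [_ [b b0 sb]] := CP s sC.
  (* A row outside [S :|: C] exceeds every multiple of [s0] along [zeta], here the multiple
     [b / eps]. *)
  have nt : \forall z \near ultra zeta, y z s0 <= eps / b * y z t.
    have eb0 : 0 < b / eps by rewrite divr_gt0.
    have [tb|] := in_ultra_setVsetC [set z | y z t <= b / eps * y z s0] (ultraP zeta).
      by case/negP: tC; rewrite inE tS; apply/asboolP; exists (b / eps).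
    apply: filterS => z /= /negP; rewrite -ltNge => /ltW h.
    rewrite -(ler_pM2l eb0) (le_trans h) // mulrA.
    by rewrite (_ : b / eps * (eps / b) = 1) ?mul1r //; field; rewrite !gt_eqF.
  apply: filterS2 sb nt => z zs zt; apply: le_trans zs _.
  by rewrite -(ler_pM2l b0) mulrA [b * (eps / b)]mulrC divfK ?gt_eqF // in zt.
- apply: proper_card; apply/properP; split; first exact: finset.subsetUl.
  by exists s0; rewrite // inE s0C orbT.
Unshelve. all: by end_near.
Qed.

(** Each use of [lowest_class] strictly enlarges [S]; asking for [r.+1] rows or the full set forces
    the full set. *)
Lemma solves_all (p : beta posnat_semigroup) :
  @minimal_idempotent (beta posnat_semigroup) p ->
  exists z, solves G K p [set: 'I_r]%SET z.
Proof.
move=> mp.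
have H n : exists S : {set 'I_r}, [/\ down S, (n <= #|S|)%N || (S == [set: 'I_r]%SET) &
    exists z, solves G K p S z].
  elim: n => [|n [S [dS nS [z Sz]]]].
    exists finset.set0; split => //; last exact: solves0.
    by move=> s t eps; rewrite inE.
  have [ST|ST] := eqVneq S [set: 'I_r]%SET.
    by exists S; split => //; [rewrite ST eqxx orbT|exists z].
  have [C [v [dSC cSC vS vC vK]]] := lowest_class dS ST.
  exists (S :|: C); split => //.
    rewrite (negbTE ST) orbF in nS.
    by rewrite (leq_ltn_trans nS cSC).
  exact: solves_step Sz vS vC vK.
have [S [_ cS Sz]] := H r.+1.
have cr : (#|S| <= r)%N by rewrite -[leqRHS]card_ord max_card.
move: cS; rewrite leqNgt ltnS cr /= => /eqP ST.
by rewrite -ST.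
Qed.

End MonochromaticUltrafilter.

(** The solution sets of the finite colourings generate a proper filter, two colourings being
    refined by their product; any finer ultrafilter will do. *)
Lemma ipr_ultrafilter (k m : nat) (M : 'M[rat]_(k, m)) : image_partition_regular M ->
  exists zeta : beta 'cV[rat]_m,
    [/\ forall j, \forall z \near ultra zeta, 1 <= (z : 'cV[rat]_m) j ord0,
        forall i, \forall z \near ultra zeta, 1 <= (M *m z) i ord0 &
        forall (i i' : 'I_k) (C : finType) (c : rat -> C),
          \forall z \near ultra zeta, c ((M *m z) i ord0) = c ((M *m z) i' ord0)].
Proof.
move=> ipr.
have ge1 x : 1 <= posnat_rat x by rewrite /posnat_rat ler1n; case: x.
pose mono (C : finType) (c : posnat -> C) : set 'cV[rat]_m :=
  [set z | exists z' x, [/\ z = map_mx posnat_rat z',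
    M *m map_mx posnat_rat z' = map_mx posnat_rat x & exists a, forall i, c (x i ord0) = a]].
pose F : set_system 'cV[rat]_m := [set A | exists (C : finType) (c : posnat -> C), mono C c `<=` A].
have FF : ProperFilter F.
  split.
    move=> [C [c]]; have [z [x [zx xa]]] := ipr C c.
    by move=> /(_ (map_mx posnat_rat z)); apply; exists z, x.
  constructor.
  - by exists unit, (fun=> tt).
  - move=> A B [C [c cA]] [C' [c' cB]].
    exists (C * C')%type, (fun x => (c x, c' x)) => _ [z [x [-> zx [[a a'] xa]]]].
    split; [apply: cA|apply: cB]; exists z, x; split => //.
      by exists a => i; have [] := xa i.
    by exists a' => i; have [] := xa i.
  - by move=> A B AB [C [c cA]]; exists C, c; apply: subset_trans AB.
have [U [UU FU]] := ultraFilterLemma FF.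
exists (Beta UU); split => [j|i|i i' C c]; apply: FU.
- by exists unit, (fun=> tt) => _ [z [x [-> _ _]]]; rewrite /= mxE.
- by exists unit, (fun=> tt) => _ [z [x [-> zx _]]]; rewrite /= zx mxE.
- exists C, (c \o posnat_rat) => _ [z [x [-> zx [a xa]]]].
  by rewrite /= zx !mxE; move: (xa i) (xa i') => /= -> ->.
Qed.

Lemma ipr_idempotent (k m : nat) (M : 'M[rat]_(k, m)) (p : beta posnat_semigroup) :
  image_partition_regular M -> @minimal_idempotent (beta posnat_semigroup) p ->
  exists z : beta (Algebra.to_multiplicative 'cV[rat]_m),
    [/\ (z * z)%g = z,
        forall j, \forall x \near ultra z, exists n, (x : 'cV[rat]_m) j ord0 = posnat_rat n &
        forall i, beta_map (fun x : 'cV[rat]_m => (M *m x) i ord0) z = beta_map posnat_rat p].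
Proof.
move=> ipr mp; have [zeta [z1 Mz1 Mz]] := ipr_ultrafilter ipr.
(* The identity rows make the entries of the vector positive integers; the rows of [M] are those
   sent to [p]. *)
pose G := col_mx 1%:M M : 'M[rat]_(m + k, m).
pose K := [set rshift m i | i : 'I_k]%SET.
have Gl (z : 'cV[rat]_m) j : (G *m z) (lshift k j) ord0 = z j ord0.
  by rewrite mul_col_mx col_mxEu mul1mx.
have Gr (z : 'cV[rat]_m) i : (G *m z) (rshift m i) ord0 = (M *m z) i ord0.
  by rewrite mul_col_mx col_mxEd.
have [|s t C c|z [zz zZ zpos zK]] := @solves_all _ _ G K zeta _ _ p mp.
- move=> s; case: (split_ordP s) => j ->.
    by apply: filterS (z1 j) => z; rewrite Gl.
  by apply: filterS (Mz1 j) => z; rewrite Gr.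
- by move=> /imsetP[i _ ->] /imsetP[i' _ ->]; apply: filterS (Mz i i' C c) => z; rewrite !Gr.
exists z; split => // [j|i].
  apply: filterS2 (zZ (lshift k j)) (zpos (lshift k j) (finset.in_setT _)) => x.
  by rewrite Gl; exact: posnat_ratP.
rewrite -(zK (rshift m i)) ?finset.in_setT //; last exact: imset_f.
by apply: eq_beta_map; apply: filterE => x; rewrite Gr.
Qed.

(** * Words *)

Lemma filter_bigI_finite (T I : Type) (D : set I) (f : I -> set T) (F : set_system T) :
  Filter F -> finite_set D -> (forall i, D i -> F (f i)) -> F (\bigcap_(i in D) f i).
Proof.
move=> FF; elim/Pchoice: I => I in D f *.
by move=> /finite_fsetP[E ->]; exact: filter_bigI.
Qed.

Section Words.
Local Open Scope group_scope.
Variables (A : finType) (n : nat).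
Local Notation word := (word A).
Local Notation varword := (varword A n).

Lemma occurrencesM j (v w : varword) :
  occurrences j (v * w) = (occurrences j v + occurrences j w)%N.
Proof. exact: count_cat. Qed.

Lemma count_embed_word (j : 'I_n) (u : word) : count_mem (inr j) (embed_word n u) = 0%N.
Proof.
by rewrite /embed_word count_map; apply/eqP; rewrite -leqn0 leqNgt -has_count; apply/hasPn.
Qed.

Lemma occurrences_lmul j u (w : varword) : occurrences j (varword_lmul u w) = occurrences j w.
Proof. by rewrite /occurrences /= count_cat count_embed_word. Qed.

Lemma occurrences_rmul j u (w : varword) : occurrences j (varword_rmul w u) = occurrences j w.
Proof. by rewrite /occurrences /= count_cat count_embed_word addn0. Qed.

Lemma varword_of_occurrences (c : 'I_n -> nat) : (0 < n)%N -> (forall j, 0 < c j)%N ->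
  exists w : varword, forall j, occurrences j w = c j.
Proof.
move=> n0 c0; pose s : seq (A + 'I_n) := flatten [seq nseq (c j) (inr j) | j <- enum 'I_n].
have cs j : count_mem (inr j) s = c j.
  rewrite count_flatten sumnE !big_map -enumT big_enum /= (bigD1 j) //= count_nseq /= eqxx mul1n.
  rewrite big1 ?addn0 // => i ij; rewrite count_nseq /=.
  rewrite (_ : (inr i == inr j :> A + 'I_n) = false) //.
  by apply/negbTE; apply: contra ij => /eqP[->].
have sj j : inr j \in s by rewrite -has_pred1 has_count cs.
have sw : is_varword s.
  apply/andP; split; last exact/forallP.
  by have := sj (Ordinal n0); case: s {cs sj}.
by exists (exist _ s sw).
Qed.

(* S_0 and S_n together: a semigroup with S_n as an ideal, so that S_0-preserving homomorphisms
   extend to retractions onto S_0. *)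
Definition mixed_word : Type := (word + varword)%type.

HB.instance Definition _ := Choice.on mixed_word.

Definition mixed_mul (s t : mixed_word) : mixed_word :=
  match s, t with
  | inl u, inl v => inl (u * v)
  | inl u, inr w => inr (varword_lmul u w)
  | inr w, inl u => inr (varword_rmul w u)
  | inr v, inr w => inr (v * w)
  end.

Lemma mixed_mulA : associative mixed_mul.
Proof.
move=> [u|u] [v|v] [w|w] /=; congr (_ _); apply: val_inj => /=;
  by rewrite /embed_word ?map_cat !catA.
Qed.

HB.instance Definition _ := isSemigroup.Build mixed_word mixed_mulA.

Definition retract (nu : varword -> word) (t : mixed_word) : word :=
  match t with inl u => u | inr w => nu w end.

Lemma retractM nu : preserving_hom nu -> {morph retract nu : s t / s * t}.
Proof. by move=> [nuM nul nur] [u|u] [v|v] //=; rewrite ?nuM ?nul ?nur. Qed.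

Variables (m : nat) (sigma : 'I_m -> 'I_n).
Local Notation Qm := (Algebra.to_multiplicative 'cV[rat]_m).

(** Words over the alphabet weigh 0, which makes [weight] a morphism on all of [mixed_word]. *)
Definition weight (t : mixed_word) : Qm :=
  match t with
  | inl u => 0%R
  | inr w => (\col_(j < m) (occurrences (sigma j) w)%:R)%R
  end.

Lemma weightM : {morph weight : s t / s * t}.
Proof.
have addE (x y : 'cV[rat]_m) : (x : Qm) * (y : Qm) = (x + y)%R by [].
move=> [u|u] [v|v]; rewrite addE ?addr0 ?add0r //=; apply/matrixP => i j; rewrite !mxE.
- by rewrite occurrences_lmul.
- by rewrite occurrences_rmul.
- by rewrite occurrencesM natrD.
Qed.

Lemma weight_surj (z : 'cV[rat]_m) : injective sigma -> (0 < n)%N ->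
  (forall j, exists a, z j ord0 = posnat_rat a) -> exists t, weight t = z.
Proof.
move=> sI n0 /choice[a za].
(* Variables outside the range of [sigma] occur once, since every variable has to occur. *)
pose c j := if [pick i | sigma i == j] is Some i then val (a i) else 1%N.
have [j|w wc] := @varword_of_occurrences c n0.
  by rewrite /c; case: pickP => // i _; exact: (valP (a i)).
exists (inr w); apply/matrixP => i j; rewrite mxE wc ord1 za /c.
case: pickP => [i' /eqP /sI -> //|/(_ i)]; by rewrite eqxx.
Qed.

End Words.

(** * Compactness, products and diagonal points of the set P *)

Section Main.
Local Open Scope group_scope.
Variables (A : finType) (k m n : nat) (M : 'M[rat]_(k, m)) (F : set (varword A n -> word A)).
Variable sigma : 'I_m -> 'I_n.
Hypothesis hF : forall nu, F nu -> preserving_hom nu.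

(** Membership of [B i] in [p i] is an open condition: a point of [P_set] close enough to a cluster
    point [p] shares it, and its word serves for [p]. So the set is closed in a compact product. *)
Lemma P_set_compact : compact (P_set M F sigma).
Proof.
apply: (@subclosed_compact (beta_pow posnat_semigroup k) _
  [set f : forall i : 'I_k, beta posnat | forall i, [set: beta posnat] (f i)]).
- move=> p clp D B Dps pB.
  have nB i : nbhs p [set q : beta_pow posnat_semigroup k | ultra (q i) (B i)].
    apply: (@proj_continuous 'I_k (fun=> beta posnat) i p (beta_base (B i))).
    by apply: open_nbhs_nbhs; split; [exact: beta_base_open|exact: pB].
  have [q [Pq qB]] := clp _ (filter_forall _ nB).
  exact: Pq.
- exact: (@tychonoff 'I_k (fun=> beta posnat) (fun=> setT)) (fun=> @beta_compact _).
- by [].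
Qed.

Hypothesis hFfin : finite_set F.

(** [D] is met in two stages: a word [w] from [p] puts the translates of [D1] by the finitely many
    [nu w] into [e], and a word from [q] lands in their intersection [D2]. The weights add up as in
    the definition of [p * q]. *)
Lemma P_set_mul p q : P_set M F sigma p -> P_set M F sigma q -> P_set M F sigma (p * q).
Proof.
move=> Pp Pq D B /piecewise_syndetic_idempotent[x [e [[Ke ee] eD]]] pqB.
pose D1 := [set y | D (x * y)].
have De : \forall y \near ultra e, \forall y' \near ultra e, D1 (y * y').
  by have : ultra (e * e) D1 by rewrite ee.
have [w [wD [a [Ma aB]]]] := Pp _
  (fun i => [set b : posnat | \forall b' \near ultra (q i), B i (posnat_add b b')])
  (ex_intro2 _ _ e Ke De) pqB.
pose D2 := \bigcap_(nu in F) [set y' | D1 (nu w * y')].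
have D2e : ultra e D2 by apply: filter_bigI_finite => // nu /wD.
have [w' [wD' [a' [Ma' aB']]]] := Pq _ _ (ex_intro2 _ _ e Ke D2e) aB.
exists (varword_lmul x (w * w')); split.
  move=> nu Fnu; have [nuM nul _] := hF Fnu.
  by rewrite nul nuM; exact: (wD' _ Fnu _ Fnu).
exists (\col_i posnat_add (a i ord0) (a' i ord0))%R; split; last first.
  by move=> i; rewrite mxE; exact: aB'.
transitivity (map_mx posnat_rat a + map_mx posnat_rat a')%R; last first.
  by apply/matrixP => i j; rewrite !mxE posnat_ratD !ord1.
rewrite -Ma -Ma' -mulmxDr; congr mulmx; apply/matrixP => i j.
by rewrite !mxE occurrences_lmul occurrencesM natrD.
Qed.

Lemma P_set_minimal_idempotent p : (0 < k)%N -> (0 < n)%N -> image_partition_regular M ->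
  injective sigma -> @minimal_idempotent (beta posnat_semigroup) p ->
  P_set M F sigma (fun=> p).
Proof.
move=> k0 n0 ipr sI mp D B /piecewise_syndetic_idempotent[x [e [me eD]]] pB.
have [z [zz zpos zM]] := ipr_idempotent ipr mp.
pose T := mixed_word A n.
pose e' : beta T := beta_map inl e.
have ee' : e' * e' = e'.
  by rewrite -(beta_mapM (f := inl : word A -> T)) ?me.2.
pose mu := @weight A n m sigma; have muM := @weightM A n m sigma.
pose Z := [set w : beta T | beta_map mu w = z].
(* A section of the weight, to lift [z]; off the positive integer vectors its value is arbitrary. *)
have [g gK] : exists g : 'cV[rat]_m -> T, forall y : 'cV[rat]_m,
    (forall j, exists a, y j ord0 = posnat_rat a) -> mu (g y) = y.
  have [u0 _] := filter_ex (filterT : ultra e setT).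
  have ex (y : 'cV[rat]_m) : exists t : T,
      (forall j, exists a, y j ord0 = posnat_rat a) -> mu t = y.
    have [/(weight_surj A sI n0)[t tE]|ny] :=
      pselect (forall j, exists a, y j ord0 = posnat_rat a); first by exists t.
    by exists (inl u0 : T).
  by have [g gK] := choice ex; exists g.
have Z0 : Z !=set0.
  exists (beta_map g z); rewrite /Z /= beta_map_comp beta_map_id //.
  by apply: filterS (filter_forall _ zpos) => y /gK.
have addE (y y' : 'cV[rat]_m) : (y : Algebra.to_multiplicative 'cV[rat]_m) * y' = (y + y')%R by [].
(* [e'] lives on words of weight 0, so multiplying by it leaves the weight [z] unchanged. *)
have eZ w : Z w -> Z (e' * w) /\ Z (w * e').
  move=> Zw; rewrite /Z /= !(beta_mapM muM) Zw; split; apply/esym/beta_eqP => C zC.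
    apply: (@beta_mul_near _ (beta_map mu e') z C).
    suff : \forall u \near ultra e, \forall y \near ultra z, C (mu (inl u) * y) by [].
    by apply: filterE => u; apply: filterS zC => y; rewrite addE add0r.
  apply: (@beta_mul_near _ z (beta_map mu e') C); apply: filterS zC => y yC.
  suff : \forall u \near ultra e, C (y * mu (inl u)) by [].
  by apply: filterE => u; rewrite addE addr0.
have [w [Zw ww ew we]] := squeezed_idempotent (beta_map_fiber_closed (q := z))
  Z0 (beta_fiber_mul_closed muM zz) ee' eZ.
(* The image of [w] is an idempotent below [e], so minimality makes it [e]. *)
have nuw nu : F nu -> beta_map (retract nu) w = e.
  move=> /hF/retractM nuM.
  have nue : beta_map (retract nu) e' = e.
    by rewrite beta_map_comp beta_map_id //; apply: filterE.
  apply: (minimal_idempotent_le me); rewrite -1?[in LHS]nue -(beta_mapM nuM) ?ww ?ew ?we //.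
have wD : \forall t \near ultra w, (\bigcap_(nu in F) [set t | D (x * retract nu t)]) t.
  apply: filter_bigI_finite => // nu Fnu.
  have : ultra (beta_map (retract nu) w) [set y | D (x * y)] by rewrite nuw.
  by [].
have wB i : \forall t \near ultra w, exists2 a, B i a & ((M *m mu t) i ord0 = posnat_rat a)%R.
  have : ultra (beta_map posnat_rat p) [set posnat_rat a | a in B i].
    by apply: (filterS _ (pB i)) => a Ba; exists a.
  rewrite -(zM i) -Zw /=; apply: filterS => t [a Ba aE]; by exists a.
(* A word without variables has weight 0 and cannot give the positive entry required in a row of
   [M]. *)
have [[u|v] [tD tB]] := filter_ex (filterI wD (filter_forall _ wB)).
  have [a _] := tB (Ordinal k0).
  by rewrite mulmx0 mxE => a0; have := posnat_rat_gt0 a; rewrite -a0 ltxx.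
have /choice[a aP] i : exists a, B i a /\ ((M *m mu (inr v)) i ord0 = posnat_rat a)%R.
  by have [a Ba aE] := tB i; exists a.
exists (varword_lmul x v); split.
  by move=> nu Fnu; have [_ nul _] := hF Fnu; rewrite nul; exact: tD.
exists (\col_i a i)%R; split; last by move=> i; rewrite mxE; have [] := aP i.
apply/matrixP => i j; rewrite ord1 [RHS]mxE [X in posnat_rat X]mxE -(aP i).2.
by rewrite /mu /=; congr ((M *m _) _ _); apply/matrixP => s t; rewrite !mxE occurrences_lmul.
Qed.

End Main.

Theorem theorem4p6 (A : finType) (hA : (0 < #|A|)%N) (k m n : nat)
  (hk : (0 < k)%N) (hm : (0 < m)%N) (hmn : (m <= n)%N)
  (M : 'M[rat]_(k, m)) (hM : image_partition_regular M)
  (F : set (varword A n -> word A)) (hFfin : finite_set F) (hF0 : F !=set0)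
  (hF : forall nu, F nu -> preserving_hom nu)
  (sigma : 'I_m -> 'I_n) (hsigma : injective sigma) :
  compact (P_set M F sigma) /\
  subsemigroup (P_set M F sigma) /\
  [set (fun _ => p) | p in @minimal_idempotent (beta posnat_semigroup)]
    `<=` P_set M F sigma.
Proof.
have n0 : (0 < n)%N := leq_trans hm hmn.
have Pmin := P_set_minimal_idempotent hF hFfin hk n0 hM hsigma.
split; first exact: P_set_compact.
split; last by move=> _ [p mp <-]; exact: Pmin.
split; last by move=> p q; exact: P_set_mul.
have [p mp] := @minimal_idempotent_ex posnat_semigroup (principal (exist _ 1%N isT)).
by exists (fun=> p); exact: Pmin.
Qed.
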